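(* Let $Z$ be a non-empty set, $F$ a correspondence from $Z$ to $Z$ with non-empty values, and $r$ a mapping from $Z$ to $[0,1]$. Assume that $Z$ is endowed with a distance $d$ such that: (a) $(Z,d)$ is a precompact metric space, (b) $r$ is uniformly continuous, and (c) $F$ is non-expansive, i.e. for all $z,z'\in Z$ and all $z_1\in F(z)$ there exists $z_1'\in F(z')$ such that $d(z_1,z_1')\leq d(z,z')$. Then for every initial state $z$ in $Z$, the problem $\Gamma(z)=(Z,F,r,z)$ has a uniform value, which is $$v^*(z)=\underline{v}(z)=v^+(z)=v^-(z)=\sup_{m\geq 0}\inf_{n\geq 1}v_{m,n}(z)=\sup_{m\geq 0}\inf_{n\geq 1}w_{m,n}(z).$$ Moreover, the sequence of functions $(v_n)_{n\geq 1}$ converges uniformly on $Z$ to $v^*$.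
   Context: A correspondence $F$ from $Z$ to $Z$ assigns to each $z\in Z$ a subset $F(z)\subseteq Z$. For $z_0\in Z$, a play at $z_0$ is a sequence $s=(z_1,z_2,\dots)\in Z^\infty$ with $z_t\in F(z_{t-1})$ for all $t\geq 1$; $S(z_0)$ is the set of plays at $z_0$. For a play $s=(z_t)_{t\geq 1}$, $m\geq 0$, $n\geq 1$: $\gamma_n(s)=\frac1n\sum_{t=1}^n r(z_t)$, $\gamma_{m,n}(s)=\frac1n\sum_{t=1}^n r(z_{m+t})$, $\nu_{m,n}(s)=\min\{\gamma_{m,t}(s): t\in\{1,\dots,n\}\}$. For $z\in Z$: $v_n(z)=\sup_{s\in S(z)}\gamma_n(s)$, $v_{m,n}(z)=\sup_{s\in S(z)}\gamma_{m,n}(s)$, $w_{m,n}(z)=\sup_{s\in S(z)}\nu_{m,n}(s)$; $v^-(z)=\liminf_n v_n(z)$, $v^+(z)=\limsup_n v_n(z)$, $\underline v(z)=\sup_{s\in S(z)}\left(\liminf_n\gamma_n(s)\right)$; and $v^*(z)=\inf_{n\geq1}\sup_{m\geq0}w_{m,n}(z)=\inf_{n\geq1}\sup_{m\geq0}v_{m,n}(z)$ (the two expressions are always equal). $\Gamma(z)$ has a uniform value if $\underline v(z)=v^+(z)$; the uniform value is then this common number. Precompact means totally bounded: for every $\varepsilon>0$ the space is covered by finitely many balls of radius $\varepsilon$. *)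

(* Defs.v *)
From mathcomp Require Export all_boot all_order all_algebra.
From mathcomp Require Export all_classical all_reals.
From mathcomp Require Export topology normedtype sequences.
Export numFieldNormedType.Exports.

Set Implicit Arguments.
Unset Strict Implicit.
Unset Printing Implicit Defensive.

Import Order.TTheory GRing.Theory Num.Theory.

Local Open Scope classical_set_scope.
Local Open Scope ring_scope.

(* The library's [precompact] means "with compact closure", which is stronger
   than total boundedness when the space is not complete. *)
Definition totally_bounded (R : numDomainType) (Z : pseudoMetricType R) :=
  forall e : R, 0 < e ->
    exists2 C : set Z, finite_set C & [set: Z] `<=` \bigcup_(c in C) ball c e.

Definition nonexpansive (R : numDomainType) (Z : metricType R)
    (F : Z -> set Z) :=
  forall z z' z1 : Z, F z z1 ->
    exists2 z1' : Z, F z' z1' & mdist z1 z1' <= mdist z z'.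

(* A play (z_1, z_2, ...) is encoded by the sequence s with s t = z_(t+1); the
   initial state z0 is not part of it. *)
Definition plays (Z : Type) (F : Z -> set Z) (z0 : Z) : set (nat -> Z) :=
  [set s | F z0 (s 0%N) /\ forall t, F (s t) (s t.+1)].

(* Real [sup] and [inf] are 0 by convention on sets that are empty or
   unbounded. If F has non-empty values and r takes values in [0, 1], all those
   below are taken on non-empty subsets of [0, 1], and the lower and upper
   limits are those of bounded sequences. *)
Section values.
Context {R : realType} {Z : Type}.
Variables (F : Z -> set Z) (r : Z -> R).
Implicit Types (s : nat -> Z) (z : Z) (m n : nat).

Definition gamma n s : R := n%:R^-1 * \sum_(t < n) r (s t).

Definition gamma_from m n s : R := n%:R^-1 * \sum_(t < n) r (s (m + t)%N).

Definition nu m n s : R :=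
  \big[Num.min/gamma_from m 1 s]_(1 <= t < n.+1) gamma_from m t s.

Definition v n z : R := sup [set gamma n s | s in plays F z].

Definition v_from m n z : R := sup [set gamma_from m n s | s in plays F z].

Definition w_from m n z : R := sup [set nu m n s | s in plays F z].

Definition v_minus z : R := limn_inf (fun n => v n z).

Definition v_plus z : R := limn_sup (fun n => v n z).

Definition v_low z : R :=
  sup [set limn_inf (fun n => gamma n s) | s in plays F z].

Definition v_star z : R :=
  inf [set sup [set w_from m n z | m in [set: nat]]
      | n in [set n | (1 <= n)%N]].

Definition supinf_v z : R :=
  sup [set inf [set v_from m n z | n in [set n | (1 <= n)%N]]
      | m in [set: nat]].

Definition supinf_w z : R :=
  sup [set inf [set w_from m n z | n in [set n | (1 <= n)%N]]
      | m in [set: nat]].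

Definition has_uniform_value z := v_low z = v_plus z.

Definition is_uniform_value z (x : R) := has_uniform_value z /\ x = v_low z.

End values.

(* Main.v *)
Require Import Defs.
From mathcomp Require Import ring lra zify.

(** Why the theorem holds.

    Write U_n(z) for the supremum over m of w_{m,n}(z). It is nonincreasing in
    n and v^*(z) is its infimum. Two opposite estimates sandwich everything.

    Nothing exceeds v^*. If a long stretch of N stages has average g, then some
    stage in it starts n stages all of whose initial averages are at least
    g - n/N: otherwise one could chain short bad stretches through the long one
    ([good_start]). Hence v_{m,N}(z) <= U_n(z) + n/N for all m and n.

    Something reaches v^*. Non-expansiveness lets a play from z' shadow any
    play from z at distance at most d(z,z'), so by uniform continuity of r all
    the values are equicontinuous, uniformly in m and n. On a totally bounded
    space, an equicontinuous statement of the form (for each z, for n large)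
    then holds with n independent of z ([totally_bounded_uniform]), and this is
    used three times:
    - U_n tends to v^* uniformly, so v_{m,N} <= v^* + e for all N large,
      uniformly in m and z ([v_from_le_v_star]);
    - one delay m serves all horizons n in w_{m,n}(z) >= v^*(z) - e, because the
      states that can be reached from z are, up to a small distance, finitely
      many, and w_{0,n} is nonincreasing in n ([v_star_le_w_from]);
    - this delay is bounded uniformly in z ([v_star_le_w_from_uniform]).

    Consequently, from any state y one can, after a bounded delay, play for as
    many stages as desired with all running averages at least v^*(y) - e, and
    end at a state where v^* is still at least v^*(y) - e: what remains of a
    much longer good stretch is good as well, and the first estimate turns its
    large average into a large v^* ([good_block]). Concatenating such blocks
    with tolerances e/2^k, each long enough for the delay of the next one to
    be negligible, gives a single play whose lower limit average is at least
    v^*(z) - e ([good_play]), that is, v^* <= v_low. A single block already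
    gives v_n >= v^* - e for all n large, uniformly in z; so v_n converges
    uniformly to v^*, and the equalities follow. *)

Set Implicit Arguments.
Unset Strict Implicit.
Unset Printing Implicit Defensive.

Import Order.TTheory GRing.Theory Num.Theory.

Local Open Scope classical_set_scope.
Local Open Scope ring_scope.

(** * Suprema, infima and lower limits of real families *)

Section sup_inf_image.
Context {R : realType} {T : Type}.
Implicit Types (A : set T) (f : T -> R) (c : R) (x : T).

Lemma le_sup_image A f c x :
  (forall y, A y -> f y <= c) -> A x -> f x <= sup (f @` A).
Proof.
move=> fc Ax; apply: ub_le_sup; last by exists x.
by exists c => _ [y Ay <-]; exact: fc.
Qed.

Lemma sup_image_le A f c :
  A !=set0 -> (forall y, A y -> f y <= c) -> sup (f @` A) <= c.
Proof.
move=> [x Ax] fc; apply: ge_sup; first by exists (f x), x.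
by move=> _ [y Ay <-]; exact: fc.
Qed.

Lemma sup_image_gt A f c :
  A !=set0 -> c < sup (f @` A) -> exists2 x, A x & c < f x.
Proof.
move=> [x Ax] cA.
have fA0 : f @` A !=set0 by exists (f x), x.
by have [_ [y Ay <-] cy] := sup_gt fA0 cA; exists y.
Qed.

Lemma inf_image_le A f c x :
  (forall y, A y -> c <= f y) -> A x -> inf (f @` A) <= f x.
Proof.
move=> cf Ax; apply: ge_inf; last by exists x.
by exists c => _ [y Ay <-]; exact: cf.
Qed.

Lemma le_inf_image A f c :
  A !=set0 -> (forall y, A y -> c <= f y) -> c <= inf (f @` A).
Proof.
move=> [x Ax] cf; apply: lb_le_inf; first by exists (f x), x.
by move=> _ [y Ay <-]; exact: cf.
Qed.

Lemma inf_image_lt A f c :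
  A !=set0 -> inf (f @` A) < c -> exists2 x, A x & f x < c.
Proof.
move=> [x Ax] Ac.
have fA0 : f @` A !=set0 by exists (f x), x.
by have [_ [y Ay <-] yc] := inf_lt fA0 Ac; exists y.
Qed.

End sup_inf_image.

Section limn_inf_bounds.
Context {R : realType}.
Implicit Types (u : nat -> R) (c : R).

Lemma unit_bounded_fun u :
  (forall n, 0 <= u n <= 1) -> bounded_fun (u : nat -> R^o).
Proof.
move=> u01; exists 1; split => // M M1 n _ /=.
by have /andP[u0 u1] := u01 n; rewrite ger0_norm // (le_trans u1) // ltW.
Qed.

Lemma limn_inf_ge u c N : (forall n, 0 <= u n <= 1) ->
  (forall n, (N <= n)%N -> c <= u n) -> c <= limn_inf u.
Proof.
move=> u01 cu; have ub := unit_bounded_fun u01.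
rewrite limn_infE //; apply: (@le_trans _ _ (infs u N)).
  by apply: le_inf_image => [|n]; [exists N => /=|exact: cu].
by apply: ub_le_sup; [exact: bounded_fun_has_ubound_infs|exists N].
Qed.

Lemma limn_inf_le u c N : (forall n, 0 <= u n <= 1) ->
  (forall n, (N <= n)%N -> u n <= c) -> limn_inf u <= c.
Proof.
move=> u01 uc; rewrite limn_infE; last exact: unit_bounded_fun.
apply: sup_image_le => [|n _]; first by exists 0%N.
apply: (@le_trans _ _ (u (maxn n N))); last by apply: uc; exact: leq_maxr.
apply: (@inf_image_le _ _ _ u 0) => [k _|]; first by case/andP: (u01 k).
exact: leq_maxl.
Qed.

End limn_inf_bounds.

Lemma archi_mul (R : archiRealFieldType) (e x : R) : 0 < e ->
  exists2 N, (0 < N)%N & forall n, (N <= n)%N -> x <= e * n%:R.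
Proof.
move=> e0; exists (Num.truncn (x / e)).+1 => // n Nn.
rewrite mulrC -ler_pdivrMr //; apply/ltW/(lt_le_trans (truncnS_gt _)).
by rewrite ler_nat.
Qed.

(** * Averages of sequences in the unit interval *)

Lemma sum_nat_split (V : nmodType) (a : nat -> V) m n :
  \sum_(i < m + n) a i = \sum_(i < m) a i + \sum_(i < n) a (m + i)%N.
Proof. by rewrite big_split_ord. Qed.

Section unit_interval_sequences.
Context {R : realType}.
Variable a : nat -> R.
Hypothesis a01 : forall i, 0 <= a i <= 1.

Lemma sum_unit_ge0 m n : 0 <= \sum_(i < n) a (m + i)%N.
Proof. by apply: sumr_ge0 => i _; case/andP: (a01 (m + i)). Qed.

Lemma sum_unit_le m n : \sum_(i < n) a (m + i)%N <= n%:R.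
Proof.
have -> : n%:R = \sum_(i < n) 1 :> R by rewrite sumr_const card_ord.
by apply: ler_sum => i _; case/andP: (a01 (m + i)).
Qed.

Lemma sum_unit_homo m n : (m <= n)%N -> \sum_(i < m) a i <= \sum_(i < n) a i.
Proof. by move=> mn; rewrite -(subnKC mn) sum_nat_split lerDl sum_unit_ge0. Qed.

(** Otherwise every position starts a nonempty stretch of at most [n] terms
    whose average is below the threshold. Put end to end from 0, these stretches
    cover the first [N] terms and overshoot by less than [n] terms, each of
    which adds at most the threshold, itself at most 1: the first [N] terms
    would have a sum smaller than it is. *)
Lemma good_start N n : (0 < N)%N -> (0 < n)%N ->
  exists k, forall t, (t <= n)%N ->
    (N%:R^-1 * \sum_(i < N) a i - n%:R / N%:R) * t%:R
      <= \sum_(i < t) a (k + i)%N.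
Proof.
move=> N0 n0; set c := N%:R^-1 * _ - _.
have [c0|c0] := leP c 0.
  (* A nonpositive threshold is met from position 0, the terms being >= 0. *)
  exists 0%N => t _; apply: le_trans (sum_unit_ge0 0 t).
  by rewrite mulr_le0_ge0 ?ler0n.
apply: contrapT => bad.
have {}bad k : exists t, [/\ (0 < t)%N, (t <= n)%N &
    \sum_(i < t) a (k + i)%N <= c * t%:R].
  apply: contrapT => badk; apply: bad; exists k => t tn.
  have [->|t0] := posnP t; first by rewrite big_ord0 mulr0.
  by apply/ltW; rewrite ltNge; apply/negP => le; apply: badk; exists t.
(* End the chain at the first junction point that is not before [K]. *)
have chain K : exists T, [/\ (K <= T)%N, (T < K + n)%N &
    \sum_(i < T) a i <= c * T%:R].
  elim: K => [|K [T [KT Tn ST]]].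
    by exists 0%N; rewrite big_ord0 mulr0.
  have [{}KT|TK] := ltnP K T; first by exists T; split=> //; lia.
  have {KT TK}KT : T = K by lia.
  have [t [t0 tn St]] := bad K; exists (K + t)%N; split; [lia|lia|].
  by rewrite sum_nat_split natrD mulrDr lerD // -KT.
have [T [NT Tn ST]] := chain N.
have Nc : c * N%:R = \sum_(i < N) a i - n%:R.
  rewrite /c; field; rewrite pnatr_eq0; lia.
have N0' : (0 : R) < N%:R by rewrite ltr0n.
have c1 : c <= 1.
  rewrite -(ler_pM2r N0') Nc mul1r.
  have := sum_unit_le 0 N; have : (0 : R) <= n%:R by exact: ler0n.
  by under eq_bigr do rewrite add0n; lra.
have S1 := sum_unit_homo NT.
have : c * T%:R <= c * N%:R + n%:R - 1.
  have -> : T%:R = N%:R + (T - N)%:R :> R by rewrite -natrD subnKC.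
  have : (T - N)%:R + 1 <= n%:R :> R by rewrite natr1 ler_nat; lia.
  have : (0 : R) <= (T - N)%:R by exact: ler0n.
  nra.
rewrite Nc; lra.
Qed.

End unit_interval_sequences.

(** * Plays: shifting, splicing, passing to the limit, shadowing *)

(** Since the initial state is not part of a play, the state reached after [m]
    moves is the term of index [m - 1], and [z] itself for [m = 0]. *)
Definition state (Z : Type) (z : Z) (s : nat -> Z) (m : nat) : Z :=
  if m is k.+1 then s k else z.

Definition splice (Z : Type) (m : nat) (s s' : nat -> Z) (t : nat) : Z :=
  if (t < m)%N then s t else s' (t - m)%N.

Section plays.
Context {Z : Type}.
Variable F : Z -> set Z.
Implicit Types (z : Z) (s : nat -> Z).

Lemma playsP z s : plays F z s <-> forall t, F (state z s t) (s t).
Proof.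
split=> [[s0 sS] [|t] //|sF]; first exact: sS.
by split=> [|t]; [exact: (sF 0%N)|exact: (sF t.+1)].
Qed.

Lemma plays_nonempty z : (forall y, F y !=set0) -> plays F z !=set0.
Proof.
move=> F0; have [f fF] := choice F0.
by exists (fun t => iter t.+1 f z); split=> [|t]; exact: fF.
Qed.

Lemma state_shift z s m t :
  state (state z s m) (fun i => s (m + i)%N) t = state z s (m + t).
Proof. by case: t => [|t]; rewrite ?addn0 // addnS. Qed.

Lemma plays_shift z s m :
  plays F z s -> plays F (state z s m) (fun i => s (m + i)%N).
Proof. by move=> /playsP sF; apply/playsP => t; rewrite state_shift. Qed.

Lemma splice_lt m s s' t : (t < m)%N -> splice m s s' t = s t.
Proof. by rewrite /splice => ->. Qed.

Lemma splice_add m s s' t : splice m s s' (m + t) = s' t.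
Proof. by rewrite /splice ltnNge leq_addr addKn. Qed.

Lemma state_splice_le z m s s' t :
  (t <= m)%N -> state z (splice m s s') t = state z s t.
Proof. by case: t => //= t; exact: splice_lt. Qed.

Lemma state_splice_add z m s s' t :
  state z (splice m s s') (m + t) = state (state z s m) s' t.
Proof.
case: t => [|t]; first by rewrite addn0 state_splice_le.
by rewrite addnS /= splice_add.
Qed.

Lemma plays_splice z m s s' :
  plays F z s -> plays F (state z s m) s' -> plays F z (splice m s s').
Proof.
move=> /playsP sF /playsP s'F; apply/playsP => t.
have [tm|mt] := ltnP t m.
  by rewrite splice_lt // state_splice_le // ltnW.
by rewrite -(subnKC mt) state_splice_add splice_add.
Qed.

End plays.

(** The plays [S k] freeze on longer and longer initial segments, and the limit
    is a play because each transition is that of some [S k]. *)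
Lemma plays_limit (Z : Type) (F : Z -> set Z) (z : Z)
    (T : nat -> nat) (S : nat -> nat -> Z) :
  (forall k, plays F z (S k)) -> (forall k, (k <= T k)%N) ->
  (forall k, (T k <= T k.+1)%N) ->
  (forall k i, (i < T k)%N -> S k.+1 i = S k i) ->
  exists2 s, plays F z s & forall k i, (i < T k)%N -> s i = S k i.
Proof.
move=> SF kT TS SS.
have Tmono k j : (T k <= T (k + j))%N.
  by elim: j => [|j IH]; rewrite ?addn0 // addnS (leq_trans IH).
have Sconst k j i : (i < T k)%N -> S (k + j)%N i = S k i.
  move=> iT; elim: j => [|j IH]; rewrite ?addn0 // addnS SS //.
  exact: leq_trans (Tmono k j).
have sE k i : (i < T k)%N -> S i.+1 i = S k i.
  move=> iT; have iT' : (i < T i.+1)%N := kT i.+1.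
  case/orP: (leq_total k i.+1) => [ki|ik].
    by rewrite -(subnKC ki) Sconst.
  by rewrite -(subnKC ik) Sconst.
exists (fun i => S i.+1 i) => //; apply/playsP => t.
have -> : state z (fun i => S i.+1 i) t = state z (S t.+1) t.
  by case: t => //= t; apply: sE; exact: leq_trans (kT t.+2).
exact: (playsP F z _).1 (SF t.+1) t.
Qed.

(** Non-expansiveness, applied at each stage to the current pair of states. *)
Lemma plays_shadow (R : realType) (Z : metricType R) (F : Z -> set Z)
    (z z' : Z) (s : nat -> Z) :
  nonexpansive F -> (forall y, F y !=set0) -> plays F z s ->
  exists2 s', plays F z' s' & forall t, mdist (s t) (s' t) <= mdist z z'.
Proof.
move=> Fne F0 sF.
have /choice[g gP] (u : Z * Z * Z) : exists y, F u.1.1 u.2 ->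
      F u.1.2 y /\ mdist u.2 y <= mdist u.1.1 u.1.2.
  case: u => [[x x'] x1] /=.
  have [Fx|nFx] := pselect (F x x1); last by exists x.
  by have [y Fy xy] := Fne x x' x1 Fx; exists y.
pose s' := fix s' t := g (state z s t, if t is k.+1 then s' k else z', s t).
have s'E t : s' t = g (state z s t, state z' s' t, s t) by case: t.
have s'P t : F (state z' s' t) (s' t) /\
    mdist (s t) (s' t) <= mdist (state z s t) (state z' s' t).
  rewrite (s'E t); apply: (gP (state z s t, state z' s' t, s t)).
  exact: (playsP F z s).1 sF t.
exists s'; first by apply/playsP => t; exact: (s'P t).1.
elim=> [|t IH]; first exact: (s'P 0%N).2.
exact: le_trans (s'P t.+1).2 IH.
Qed.

(** * Averages along a sequence of states *)

Section averages.
Context {R : realType} {Z : Type}.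
Variable r : Z -> R.
Implicit Types (s : nat -> Z) (m n t : nat) (c : R).

Lemma gammaE n s : gamma r n s = gamma_from r 0 n s.
Proof. by []. Qed.

Lemma le_gamma_from m n s c : (0 < n)%N ->
  (c <= gamma_from r m n s) = (c * n%:R <= \sum_(t < n) r (s (m + t)%N)).
Proof.
by move=> n0; rewrite /gamma_from ler_pdivlMl ?ltr0n // mulrC.
Qed.

(** Sums rather than averages: thresholds for consecutive stretches then add
    up, and the case [t = 0] is harmless. *)
Lemma le_nuP m n s c : (0 < n)%N ->
  (c <= nu r m n s) <->
  (forall t, (t <= n)%N -> c * t%:R <= \sum_(i < t) r (s (m + i)%N)).
Proof.
move=> n0; split=> [cnu t tn|cS].
  have [->|t0] := posnP t; first by rewrite big_ord0 mulr0.
  rewrite -le_gamma_from //; apply: le_trans cnu _.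
  by apply: (@ge_bigmin_seq _ _ _ _ _ t); rewrite // mem_index_iota t0.
rewrite /nu big_nat_cond; apply: (big_ind (fun x => c <= x)) => [|x y cx cy|t].
- by rewrite le_gamma_from //; exact: cS.
- by rewrite le_min cx.
- by rewrite andbT => /andP[t0 tn]; rewrite le_gamma_from //; exact: cS.
Qed.

Lemma nu_le_gamma_from m n s : (0 < n)%N -> nu r m n s <= gamma_from r m n s.
Proof. by move=> n0; rewrite le_gamma_from //; exact: (le_nuP m s _ n0).1. Qed.

Lemma nu_shift m n s : nu r 0 n (fun i => s (m + i)%N) = nu r m n s.
Proof. by []. Qed.

Lemma gamma_from_close m n s s' e :
  0 <= e -> (forall t, r (s t) <= r (s' t) + e) ->
  gamma_from r m n s <= gamma_from r m n s' + e.
Proof.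
move=> e0 ss'; have [->|n0] := posnP n.
  by rewrite /gamma_from invr0 !mul0r add0r.
rewrite -lerBlDr le_gamma_from // mulrBl.
have -> : gamma_from r m n s * n%:R = \sum_(t < n) r (s (m + t)%N).
  by rewrite /gamma_from mulrC mulrA divff ?mul1r // pnatr_eq0 -lt0n.
have -> : e * n%:R = \sum_(t < n) e by rewrite sumr_const card_ord mulr_natr.
rewrite lerBlDr -big_split /=.
exact: ler_sum.
Qed.

Lemma nu_close m n s s' e :
  0 <= e -> (0 < n)%N -> (forall t, r (s t) <= r (s' t) + e) ->
  nu r m n s <= nu r m n s' + e.
Proof.
move=> e0 n0 ss'; rewrite -lerBlDr; apply/le_nuP => // t tn.
have [->|t0] := posnP t; first by rewrite big_ord0 mulr0.
rewrite -le_gamma_from // lerBlDr.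
apply: le_trans (gamma_from_close _ _ e0 ss').
by rewrite le_gamma_from //; exact: (le_nuP m s _ n0).1.
Qed.

Hypothesis r01 : forall z, 0 <= r z <= 1.

Lemma gamma_from_ge0 m n s : 0 <= gamma_from r m n s.
Proof.
apply: mulr_ge0; first by rewrite invr_ge0 ler0n.
exact: (sum_unit_ge0 (a := r \o s) (fun=> r01 _)).
Qed.

Lemma gamma_from_le1 m n s : gamma_from r m n s <= 1.
Proof.
have [->|n0] := posnP n; first by rewrite /gamma_from invr0 mul0r.
rewrite /gamma_from ler_pdivrMl ?ltr0n // mulr1.
exact: (sum_unit_le (a := r \o s) (fun=> r01 _)).
Qed.

Lemma nu_le1 m n s : nu r m n s <= 1.
Proof. exact: le_trans (bigmin_le_id _ _ _ _) (gamma_from_le1 _ _ _). Qed.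

Lemma nu_ge0 m n s : (0 < n)%N -> 0 <= nu r m n s.
Proof.
move=> n0; apply/le_nuP => // t _.
rewrite mul0r; exact: (sum_unit_ge0 (a := r \o s) (fun=> r01 _)).
Qed.

(** The source of every upper bound by [v_star]: a good average over a long
    horizon forces a good worst average over a short one. *)
Lemma gamma_from_le_nu m N n s : (0 < N)%N -> (0 < n)%N ->
  exists m', gamma_from r m N s - n%:R / N%:R <= nu r m' n s.
Proof.
move=> N0 n0.
have [k kP] := good_start (a := fun i => r (s (m + i)%N)) (fun=> r01 _) N0 n0.
exists (m + k)%N; apply/le_nuP => // t /kP; rewrite /gamma_from.
by under [X in _ <= X -> _]eq_bigr do rewrite addnA.
Qed.

End averages.

(** * Elementary relations between the values *)

(** The sequence, nonincreasing in [n >= 1], of which [v_star] is by definition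
    the infimum. *)
Definition w_sup (R : realType) (Z : Type) (F : Z -> set Z) (r : Z -> R)
    (n : nat) (z : Z) : R :=
  sup [set w_from F r m n z | m in [set: nat]].

Section values.
Context {R : realType} {Z : Type}.
Variables (F : Z -> set Z) (r : Z -> R).
Hypothesis F0 : forall z, F z !=set0.
Hypothesis r01 : forall z, 0 <= r z <= 1.
Implicit Types (s : nat -> Z) (m n t : nat) (c : R).

Let plays0 z : plays F z !=set0. Proof. exact: plays_nonempty. Qed.

Let nat0 : [set: nat] !=set0. Proof. by exists 0%N. Qed.

Let pos0 : [set n | (1 <= n)%N] !=set0. Proof. by exists 1%N. Qed.

Lemma nu_le_w_from m n z s : plays F z s -> nu r m n s <= w_from F r m n z.
Proof. by apply: (@le_sup_image _ _ _ (nu r m n) 1) => y _; exact: nu_le1. Qed.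

Lemma w_from_le m n z c :
  (forall s, plays F z s -> nu r m n s <= c) -> w_from F r m n z <= c.
Proof. exact: sup_image_le. Qed.

Lemma w_from_gt m n z c :
  c < w_from F r m n z -> exists2 s, plays F z s & c < nu r m n s.
Proof. exact: sup_image_gt. Qed.

Lemma gamma_from_le_v_from m n z s :
  plays F z s -> gamma_from r m n s <= v_from F r m n z.
Proof.
by apply: (@le_sup_image _ _ _ (gamma_from r m n) 1) => y _;
  exact: gamma_from_le1.
Qed.

Lemma v_from_le m n z c :
  (forall s, plays F z s -> gamma_from r m n s <= c) -> v_from F r m n z <= c.
Proof. exact: sup_image_le. Qed.

Lemma vE n z : v F r n z = v_from F r 0 n z.
Proof. by []. Qed.

Lemma w_from_ge0 m n z : (0 < n)%N -> 0 <= w_from F r m n z.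
Proof.
move=> n0; have [s sF] := plays0 z.
exact: le_trans (nu_ge0 r01 m s n0) (nu_le_w_from _ _ sF).
Qed.

Lemma w_from_le1 m n z : w_from F r m n z <= 1.
Proof. by apply: w_from_le => s _; exact: nu_le1. Qed.

Lemma w_from_le_v_from m n z : (0 < n)%N ->
  w_from F r m n z <= v_from F r m n z.
Proof.
move=> n0; apply: w_from_le => s sF.
exact: le_trans (nu_le_gamma_from r m s n0) (gamma_from_le_v_from _ _ sF).
Qed.

Lemma v_from_ge0 m n z : (0 < n)%N -> 0 <= v_from F r m n z.
Proof.
by move=> n0; apply: le_trans (w_from_ge0 m z n0) (w_from_le_v_from _ _ _).
Qed.

Lemma w_from_anti m n n' z : (0 < n)%N -> (n <= n')%N ->
  w_from F r m n' z <= w_from F r m n z.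
Proof.
move=> n0 nn'; apply: w_from_le => s sF.
apply: le_trans (nu_le_w_from _ _ sF).
have n'0 := leq_trans n0 nn'.
apply/le_nuP => // t tn.
exact: (le_nuP r m s (nu r m n' s) n'0).1 (lexx _) t (leq_trans tn nn').
Qed.

Lemma w_from_le_w_sup m n z : w_from F r m n z <= w_sup F r n z.
Proof.
apply: (@le_sup_image _ _ _ (fun m => w_from F r m n z) 1) => // k _.
exact: w_from_le1.
Qed.

Lemma w_sup_le n z c :
  (forall m, w_from F r m n z <= c) -> w_sup F r n z <= c.
Proof. by move=> wc; apply: sup_image_le => // m _; exact: wc. Qed.

Lemma w_sup_ge0 n z : (0 < n)%N -> 0 <= w_sup F r n z.
Proof.
by move=> n0; exact: le_trans (w_from_ge0 0 z n0) (w_from_le_w_sup _ _ _).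
Qed.

Lemma w_sup_anti n n' z : (0 < n)%N -> (n <= n')%N ->
  w_sup F r n' z <= w_sup F r n z.
Proof.
move=> n0 nn'; apply: w_sup_le => m.
exact: le_trans (w_from_anti m z n0 nn') (w_from_le_w_sup _ _ _).
Qed.

Lemma v_star_le_w_sup n z : (0 < n)%N -> v_star F r z <= w_sup F r n z.
Proof.
move=> n0; apply: (@inf_image_le _ _ _ (fun n => w_sup F r n z) 0) => // k.
exact: w_sup_ge0.
Qed.

Lemma le_v_star z c :
  (forall n, (0 < n)%N -> c <= w_sup F r n z) -> c <= v_star F r z.
Proof. exact: le_inf_image. Qed.

Lemma v_star_lt z c :
  v_star F r z < c -> exists2 n, (0 < n)%N & w_sup F r n z < c.
Proof. exact: inf_image_lt. Qed.

Lemma v_star_ge0 z : 0 <= v_star F r z.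
Proof. by apply: le_v_star => n; exact: w_sup_ge0. Qed.

Lemma v_star_le1 z : v_star F r z <= 1.
Proof.
apply: le_trans (v_star_le_w_sup z (ltn0Sn 0)) _.
by apply: w_sup_le => m; exact: w_from_le1.
Qed.

Lemma v_from_le_w_sup m N n z : (0 < N)%N -> (0 < n)%N ->
  v_from F r m N z <= w_sup F r n z + n%:R / N%:R.
Proof.
move=> N0 n0; apply: v_from_le => s sF.
have [k kP] := gamma_from_le_nu r01 m s N0 n0.
rewrite -lerBlDr; apply: le_trans kP _.
exact: le_trans (nu_le_w_from _ _ sF) (w_from_le_w_sup _ _ _).
Qed.

(** With [nu_le_w_from_state], this says that [w_from F r m n z] is the supremum
    of [w_from F r 0 n] over the states that can be reached from [z] in [m]
    moves, without having to introduce the iterates of [F]. *)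
Lemma w_from_state m n z s : plays F z s ->
  w_from F r 0 n (state z s m) <= w_from F r m n z.
Proof.
move=> sF; apply: w_from_le => s' s'F.
have <- : (fun i => splice m s s' (m + i)%N) = s'.
  by apply/funext => i; exact: splice_add.
by rewrite nu_shift nu_le_w_from //; exact: plays_splice.
Qed.

Lemma nu_le_w_from_state m n z s : plays F z s ->
  nu r m n s <= w_from F r 0 n (state z s m).
Proof. by move=> sF; rewrite -nu_shift nu_le_w_from //; exact: plays_shift. Qed.

End values.

(** * Uniform estimates on a totally bounded space *)

(** The only use of total boundedness: a threshold that exists for each point
    can be chosen for all points at once when it is insensitive to small moves,
    [Q] being the slightly weaker property that survives such a move. Take the
    largest of the thresholds of the centers of a finite cover. *)
Lemma totally_bounded_uniform (R : realType) (Z : metricType R) (d : R)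
    (P Q : nat -> Z -> Prop) :
  totally_bounded Z -> 0 < d ->
  (forall n m z, (n <= m)%N -> P n z -> P m z) ->
  (forall z, exists n, P n z) ->
  (forall n c z, mdist c z < d -> P n c -> Q n z) ->
  exists N, forall z, Q N z.
Proof.
move=> Ztb d0 Pmono /choice[f fP] PQ.
have [C /finite_seqP[l ->] Ccover] := Ztb d d0.
exists (\max_(c <- l) f c)%N => z.
have [//|c /= cl] := Ccover z; rewrite ballEmdist /= => cz.
apply: (PQ _ c) => //; apply: Pmono (fP c).
exact: leq_bigmax_seq.
Qed.

Section compactness.
Context {R : realType} {Z : metricType R}.
Variables (F : Z -> set Z) (r : Z -> R).
Hypothesis F0 : forall z, F z !=set0.
Hypothesis r01 : forall z, 0 <= r z <= 1.
Hypothesis Ztb : totally_bounded Z.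
Hypothesis runif : unif_continuous r.
Hypothesis Fne : nonexpansive F.
Implicit Types (z : Z) (s : nat -> Z) (e : R).

Lemma reward_modulus e : 0 < e ->
  exists2 d, 0 < d & forall z z', mdist z z' < d -> r z <= r z' + e.
Proof.
move=> e0; have [d d0 dP] := (unif_continuousP r).1 runif e e0.
exists d => // z z' zz'.
have : ball (r z) e (r z') by apply: (dP (z, z')); rewrite /= ballEmdist.
by rewrite -ball_normE /= ltr_norml => /andP[_]; lra.
Qed.

(** One modulus for all [m] and [n]: a shadowing play stays within the initial
    distance at every stage, however late. *)
Lemma values_equicontinuous e : 0 < e ->
  exists2 d, 0 < d & forall z z', mdist z z' < d ->
    [/\ forall m n, (0 < n)%N -> w_from F r m n z <= w_from F r m n z' + e,
        forall n, (0 < n)%N -> w_sup F r n z <= w_sup F r n z' + e &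
        v_star F r z <= v_star F r z' + e].
Proof.
move=> e0; have [d d0 dP] := reward_modulus e0; exists d => // z z' zz'.
have wP m n : (0 < n)%N -> w_from F r m n z <= w_from F r m n z' + e.
  move=> n0; apply: w_from_le => // s sF.
  have [s' s'F ss'] := plays_shadow z' Fne F0 sF.
  apply: (@le_trans _ _ (nu r m n s' + e)).
    by apply: nu_close => [|//|t]; [exact: ltW|exact: dP (le_lt_trans _ zz')].
  by rewrite lerD2r nu_le_w_from.
have UP n : (0 < n)%N -> w_sup F r n z <= w_sup F r n z' + e.
  move=> n0; apply: w_sup_le => m; apply: le_trans (wP m n n0) _.
  by rewrite lerD2r w_from_le_w_sup.
split=> //; rewrite -lerBlDr; apply: le_v_star => n n0.
by rewrite lerBlDr; apply: le_trans (v_star_le_w_sup F0 r01 z n0) (UP n n0).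
Qed.

(** Dini: a monotone limit of equicontinuous functions, hence uniform. *)
Lemma w_sup_cvg_uniform e : 0 < e ->
  exists2 n, (0 < n)%N & forall z, w_sup F r n z <= v_star F r z + e.
Proof.
move=> e0; have e3 : 0 < e / 3 by lra.
have [d d0 dP] := values_equicontinuous e3.
(* Shift [n] by one, so that only positive horizons occur. *)
pose P e n z := w_sup F r n.+1 z <= v_star F r z + e.
have [| |n c z cz|n nP] :=
  @totally_bounded_uniform R Z d (P (e / 3)) (P e) Ztb d0.
- by move=> n m z nm; apply: le_trans; exact: w_sup_anti.
- move=> z; have lt : v_star F r z < v_star F r z + e / 3 by lra.
  by have [[|n] // _ /ltW nP] := v_star_lt lt; exists n.
- have [_ _ vP] := dP c z cz; rewrite metric_sym in cz.
  by have [_ UP _] := dP z c cz; have := UP n.+1 isT; rewrite /P; lra.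
- by exists n.+1.
Qed.

Lemma v_from_le_v_star e : 0 < e ->
  exists2 N, (0 < N)%N & forall n, (N <= n)%N -> forall m z,
    v_from F r m n z <= v_star F r z + e.
Proof.
move=> e0; have e2 : 0 < e / 2 by lra.
have [k k0 kP] := w_sup_cvg_uniform e2.
have [N N0 NP] := archi_mul k%:R e2.
exists N => // n Nn m z; have n0 := leq_trans N0 Nn.
have := v_from_le_w_sup F0 r01 m z n0 k0; have := kP z.
have : k%:R / n%:R <= e / 2 by rewrite ler_pdivrMr ?ltr0n //; exact: NP.
lra.
Qed.

(** If each delay [m] failed at some horizon, each reachable state would have a
    small [w_from F r 0 n] for [n] large, with [n] bounded by compactness; then
    [w_sup F r n z] would be less than [v_star F r z] for this [n]. *)
Lemma v_star_le_w_from z e : 0 < e ->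
  exists m, forall n, (0 < n)%N -> v_star F r z - e <= w_from F r m n z.
Proof.
move=> e0; have e2 : 0 < e / 2 by lra.
have [d d0 dP] := values_equicontinuous e2.
have d2 : 0 < d / 2 by lra.
apply: contrapT => bad.
have {}bad m : exists2 n, (0 < n)%N & w_from F r m n z < v_star F r z - e.
  apply: contrapT => badm; apply: bad; exists m => n n0.
  by rewrite leNgt; apply/negP => lt; apply: badm; exists n.
pose P n c := forall m s, plays F z s -> mdist c (state z s m) < d / 2 ->
  w_from F r 0 n.+1 (state z s m) <= v_star F r z - e / 2.
pose Q n y := forall m s, plays F z s -> state z s m = y ->
  w_from F r 0 n.+1 y <= v_star F r z - e / 2.
have [| | |n nP] := @totally_bounded_uniform R Z (d / 2) P Q Ztb d2.
- move=> n m c nm nP k s sF cs; apply: le_trans (nP k s sF cs).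
  exact: w_from_anti.
- move=> c.
  (* One reachable state near [c], if any, speaks for all of them. *)
  have [[m0 [s0 [s0F cs0]]]|nreach] := pselect (exists m s,
      plays F z s /\ mdist c (state z s m) < d / 2); last first.
    by exists 0%N => m s sF cs; case: nreach; exists m, s.
  have [[|n] // _ bad0] := bad m0; exists n => m s sF cs.
  have close : mdist (state z s m) (state z s0 m0) < d.
    apply: le_lt_trans (metric_triangle _ c _) _.
    by rewrite (metric_sym _ c); lra.
  have [wP _ _] := dP _ _ close; have := wP 0%N n.+1 isT.
  have := w_from_state F0 r01 m0 n.+1 s0F; lra.
- by move=> n c y cy nP m s sF sy; rewrite -sy; apply: nP; rewrite ?sy.
have : w_sup F r n.+1 z <= v_star F r z - e / 2.
  apply: w_sup_le => m; apply: w_from_le => // s sF.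
  apply: le_trans (nu_le_w_from_state r01 m n.+1 sF) _.
  exact: nP sF erefl.
have := v_star_le_w_sup F0 r01 z (ltn0Sn n); lra.
Qed.

Lemma v_star_le_w_from_uniform e : 0 < e ->
  exists M, forall z n, (0 < n)%N ->
    exists2 m, (m <= M)%N & v_star F r z - e <= w_from F r m n z.
Proof.
move=> e0; have e3 : 0 < e / 3 by lra.
have [d d0 dP] := values_equicontinuous e3.
pose P e M z := forall n, (0 < n)%N ->
  exists2 m, (m <= M)%N & v_star F r z - e <= w_from F r m n z.
have [| | |M MP] := @totally_bounded_uniform R Z d (P (e / 3)) (P e) Ztb d0.
- move=> k M z kM kP n n0; have [m mk mP] := kP n n0.
  by exists m => //; exact: leq_trans kM.
- move=> z; have [m mP] := v_star_le_w_from z e3.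
  by exists m => n n0; exists m => //; exact: mP.
- move=> M c z cz MP n n0; have [m mM mP] := MP n n0; exists m => //.
  have [wP _ _] := dP c z cz; rewrite metric_sym in cz.
  by have [_ _ vP] := dP z c cz; have := wP m n n0; lra.
- by exists M.
Qed.

(** The play is good on [L + N] stages after a delay [m <= M], but only [L] of
    them are kept: the last [N] show that the state at which the block ends has
    a large [v_from F r 0 N], hence a large [v_star]. Since [M]
    is independent of [L] and [y], the delay of the next block is known when the
    length of a block is chosen. *)
Lemma good_block e : 0 < e ->
  exists M : nat, forall L y, exists s l,
    [/\ plays F y s, (L <= l)%N,
        forall t, (t <= l)%N ->
          (v_star F r y - e) * t%:R - M%:R <= \sum_(i < t) r (s i) &
        v_star F r y - e <= v_star F r (state y s l)].
Proof.
move=> e0; have e4 : 0 < e / 4 by lra.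
have [M MP] := v_star_le_w_from_uniform e4.
have [N0 _ N0P] := v_from_le_v_star e4.
exists M => L y.
(* [N] makes the rewards of the [L] kept stages negligible in the average over
   all [L + N] stages. *)
have [N1 N10 N1P] := archi_mul (L%:R * (1 + e / 2)) e4.
pose N := maxn N0 N1.
have N_gt0 : (0 < N)%N by rewrite /N leq_max N10 orbT.
have LN_gt0 : (0 < L + N)%N by rewrite addn_gt0 N_gt0 orbT.
have [m mM wm] := MP y (L + N)%N LN_gt0.
have : v_star F r y - e / 2 < w_from F r m (L + N) y by lra.
move=> /(w_from_gt F0)[s sF /ltW/(le_nuP r m s _ LN_gt0) snu].
have r0 k n : 0 <= \sum_(i < n) r (s (k + i)%N).
  exact: (sum_unit_ge0 (a := r \o s) (fun=> r01 _)).
have x0 := v_star_ge0 F0 r01 y; have x1 := v_star_le1 F0 r01 y.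
exists s, (m + L)%N; split=> //; first exact: leq_addl.
  move=> t tmL; have [tm|/ltnW mt] := leqP t m.
    apply: le_trans (r0 0%N t).
    have : t%:R <= M%:R :> R by rewrite ler_nat (leq_trans tm).
    have : 0 <= t%:R :> R by exact: ler0n.
    nra.
  rewrite -(subnKC mt) (sum_nat_split (fun i => r (s i))) natrD.
  have /snu : (t - m <= L + N)%N by lia.
  have := r0 0%N m.
  have : m%:R <= M%:R :> R by rewrite ler_nat.
  have : 0 <= m%:R :> R by exact: ler0n.
  have : 0 <= (t - m)%:R :> R by exact: ler0n.
  rewrite /=; nra.
have := N0P N (leq_maxl _ _) 0%N (state y s (m + L)).
have := gamma_from_le_v_from r01 0 N (plays_shift (m + L) sF).
suff : v_star F r y - 3 * (e / 4) <=
    gamma_from r 0 N (fun i => s (m + L + i)%N) by lra.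
rewrite le_gamma_from //=.
have := snu (L + N)%N (leqnn _).
rewrite (sum_nat_split (fun i => r (s (m + i)%N))) natrD.
rewrite [X in _ <= _ + X](eq_bigr (fun i : 'I_N => r (s (m + L + i)%N)));
  last by move=> i _; rewrite addnA.
have := sum_unit_le (a := r \o s) (fun=> r01 _) m L.
have := N1P N (leq_maxr _ _).
have : 0 <= N%:R :> R by exact: ler0n.
have : 0 <= L%:R :> R by exact: ler0n.
rewrite /=; nra.
Qed.

End compactness.

(** * Near-optimal plays and uniform convergence *)

Section uniform_value.
Context {R : realType} {Z : metricType R}.
Variables (F : Z -> set Z) (r : Z -> R).
Hypothesis F0 : forall z, F z !=set0.
Hypothesis r01 : forall z, 0 <= r z <= 1.
Hypothesis Ztb : totally_bounded Z.
Hypothesis runif : unif_continuous r.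
Hypothesis Fne : nonexpansive F.
Implicit Types (z : Z) (s : nat -> Z) (e : R).

(** Concatenation of blocks with tolerances [h / 2 ^ k.+1], where [h = e / 2]:
    they sum to [h], so [v_star] stays above [v_star F r z - h] at the junction
    points. The other [h] pays for the delays: a block of length [l] gains
    [h * l] over the target rate, which is at least the delay [M k.+1] of the
    next block, while the first delay [M 0] is the constant [C]. *)
Lemma good_play z e : 0 < e -> exists2 s, plays F z s &
  exists C, forall t, (v_star F r z - e) * t%:R - C <= \sum_(i < t) r (s i).
Proof.
move=> e0; pose h := e / 2; have h0 : 0 < h by rewrite /h; lra.
pose p k : R := 2^-1 ^+ k.
have p_gt0 k : 0 < p k by rewrite exprn_gt0 // invr_gt0.
have pS k : p k = 2 * p k.+1 by rewrite /p exprS; field.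
have p_le1 k : p k <= 1.
  by rewrite /p exprn_ile1 // ?invr_ge0 // invf_le1 // ler1n.
have /choice[M MP] k :=
  good_block F0 r01 Ztb runif Fne (mulr_gt0 h0 (p_gt0 k.+1)).
set x := v_star F r z.
(* The last clause is the reserve with which the delay of block [k] is paid. *)
pose good k (Ts : nat * (nat -> Z)) :=
  [/\ plays F z Ts.2, (k <= Ts.1)%N,
      x - h * (1 - p k) <= v_star F r (state z Ts.2 Ts.1),
      forall t, (t <= Ts.1)%N ->
        (x - e) * t%:R - (M 0%N)%:R <= \sum_(i < t) r (Ts.2 i) &
      (x - e) * Ts.1%:R - (M 0%N)%:R + (M k)%:R <=
        \sum_(i < Ts.1) r (Ts.2 i)].
(* Stated for all pairs, so that [choice] yields a total function. *)
have step k Ts : exists Ts', good k Ts -> [/\ good k.+1 Ts', (Ts.1 <= Ts'.1)%N &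
    forall i, (i < Ts.1)%N -> Ts'.2 i = Ts.2 i].
  case: Ts => T s; have [[/= sF kT xv sS sT]|ng] := pselect (good k (T, s));
    last by exists (T, s).
  have [L L0 LP] := archi_mul (M k.+1)%:R h0.
  have [s' [l [s'F Ll s'S s'v]]] := MP k L (state z s T).
  have xh : x - h * (1 - p k.+1) <= v_star F r (state z s T) - h * p k.+1.
    by have := pS k; nra.
  have hp : 0 <= h * p k.+1 by rewrite mulr_ge0 // ltW.
  have SE u : \sum_(i < T + u) r (splice T s s' i) =
      \sum_(i < T) r (s i) + \sum_(i < u) r (s' i).
    rewrite (sum_nat_split (fun i => r (splice T s s' i))).
    congr (_ + _); apply: eq_bigr => i _; first by rewrite splice_lt.
    by rewrite splice_add.
  have Sge u : (u <= l)%N -> (x - e) * (T + u)%:R - (M 0%N)%:R + h * u%:R <=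
      \sum_(i < T + u) r (splice T s s' i).
    move=> /s'S; rewrite SE natrD.
    have : 0 <= u%:R :> R by exact: ler0n.
    have : e = h + h by rewrite /h; field.
    nra.
  exists (T + l, splice T s s')%N => _; split => /=; [split => /=| |].
  - exact: plays_splice.
  - by lia.
  - by rewrite state_splice_add; exact: le_trans s'v.
  - move=> t tTl; have [tT|/ltnW Tt] := leqP t T.
      rewrite (eq_bigr (fun i : 'I_t => r (s i))); first exact: sS.
      by move=> i _; rewrite splice_lt // (leq_trans _ tT).
    rewrite -(subnKC Tt); have := Sge (t - T)%N; rewrite leq_subLR => /(_ tTl).
    have : 0 <= h * (t - T)%:R by rewrite mulr_ge0 // ltW.
    lra.
  - by have := Sge l (leqnn _); have := LP l Ll; lra.
  - exact: leq_addr.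
  - by move=> i; exact: splice_lt.
have [f fP] := choice (fun kTs => step kTs.1 kTs.2).
have [s0 s0F] := plays_nonempty z F0.
pose Ts := fix Ts k := if k is j.+1 then f (j, Ts j) else (0%N, s0).
have TsG k : good k (Ts k).
  elim: k => [|k /(fP (k, Ts k))[] //].
  split=> //=; rewrite /p ?expr0 ?subrr ?mulr0 ?subr0 ?big_ord0 //.
    move=> t; rewrite leqn0 => /eqP ->.
    by rewrite big_ord0 mulr0 sub0r oppr_le0.
  by rewrite sub0r addNr.
have TsS k := fP (k, Ts k) (TsG k).
have [| | | |s sF sE] :=
  @plays_limit _ F z (fun k => (Ts k).1) (fun k => (Ts k).2).
- by move=> k; case: (TsG k).
- by move=> k; case: (TsG k).
- by move=> k; case: (TsS k).
- by move=> k; case: (TsS k).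
exists s => //; exists (M 0%N)%:R => t.
have [_ tT _ sS _] := TsG t.
rewrite (eq_bigr (fun i : 'I_t => r ((Ts t).2 i))); first exact: sS.
by move=> i _; rewrite (sE t) // (leq_trans _ tT).
Qed.

Lemma v_star_le_v_low z : v_star F r z <= v_low F r z.
Proof.
apply/ler_addgt0Pl => e e0; have e2 : 0 < e / 2 by lra.
have [s sF [C CP]] := good_play z e2.
have [N N0 NP] := archi_mul C e2.
have g01 n y : 0 <= gamma r n y <= 1.
  by rewrite gammaE gamma_from_ge0 // gamma_from_le1.
apply: (@le_trans _ _ (e + limn_inf (fun n => gamma r n s))).
  rewrite -lerBlDl; apply: (@limn_inf_ge _ _ _ N) => // n Nn.
  rewrite gammaE le_gamma_from; last exact: leq_trans Nn.
  by have := CP n; have := NP n Nn; rewrite /=; lra.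
rewrite lerD2l.
pose g s := limn_inf (fun n => gamma r n s).
apply: (@le_sup_image _ _ _ g 1) => // y _.
by apply: (@limn_inf_le _ _ _ 0) => // n _; case/andP: (g01 n y).
Qed.

Lemma v_low_le_v_star z : v_low F r z <= v_star F r z.
Proof.
apply: sup_image_le => [|s sF]; first exact: plays_nonempty.
apply/ler_addgt0Pl => e e0.
have [N N0 NP] := v_from_le_v_star F0 r01 Ztb runif Fne e0.
apply: (@limn_inf_le _ _ _ N) => [n|n Nn].
  by rewrite gammaE gamma_from_ge0 // gamma_from_le1.
rewrite gammaE addrC; apply: le_trans (NP n Nn 0%N z).
exact: gamma_from_le_v_from.
Qed.

Lemma v_cvg_uniform e : 0 < e -> exists N, forall n, (N <= n)%N -> forall z,
  `|v_star F r z - v F r n z| <= e.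
Proof.
move=> e0; have e2 : 0 < e / 2 by lra.
have [N1 N10 N1P] := v_from_le_v_star F0 r01 Ztb runif Fne e0.
have [M MP] := good_block F0 r01 Ztb runif Fne e2.
have [N2 N20 N2P] := archi_mul M%:R e2.
exists (maxn N1 N2) => n; rewrite geq_max => /andP[N1n N2n] z.
have n0 := leq_trans N10 N1n.
rewrite vE ler_distlC; apply/andP; split; last exact: N1P.
have [s [l [sF nl sS _]]] := MP n z.
apply: le_trans (gamma_from_le_v_from r01 0 n sF).
rewrite le_gamma_from //.
by have := sS n nl; have := N2P n N2n; rewrite /=; lra.
Qed.

Lemma v_cvg z : v F r ^~ z @ \oo --> v_star F r z.
Proof.
apply/cvgrPdist_le => e e0; have [N NP] := v_cvg_uniform e0.
by exists N => // n Nn; exact: NP.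
Qed.

Lemma v_star_le_supinf_w z : v_star F r z <= supinf_w F r z.
Proof.
apply/ler_addgt0Pl => e e0.
have [m mP] := v_star_le_w_from F0 r01 Ztb runif Fne z e0.
pose g m := inf [set w_from F r m n z | n in [set n | (1 <= n)%N]].
rewrite -lerBlDl; apply: (@le_trans _ _ (g m)).
  by apply: le_inf_image => //; exists 1%N.
apply: (@le_sup_image _ _ _ g 1) => // k _.
apply: le_trans (w_from_le1 F0 r01 k 1%N z).
by apply: (@inf_image_le _ _ _ _ 0) => // n; exact: w_from_ge0.
Qed.

Lemma supinf_w_le_supinf_v z : supinf_w F r z <= supinf_v F r z.
Proof.
apply: sup_image_le => [|m _]; first by exists 0%N.
pose g m := inf [set v_from F r m n z | n in [set n | (1 <= n)%N]].
apply: (@le_trans _ _ (g m)).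
  apply: le_inf_image => [|n n0]; first by exists 1%N.
  apply: le_trans (w_from_le_v_from F0 r01 m z n0).
  by apply: (@inf_image_le _ _ _ _ 0) => // k; exact: w_from_ge0.
apply: (@le_sup_image _ _ _ g 1) => // k _.
apply: (@le_trans _ _ (v_from F r k 1 z)).
  by apply: (@inf_image_le _ _ _ _ 0) => // n; exact: v_from_ge0.
by apply: v_from_le => // s _; exact: gamma_from_le1.
Qed.

Lemma supinf_v_le_v_star z : supinf_v F r z <= v_star F r z.
Proof.
apply: sup_image_le => [|m _]; first by exists 0%N.
apply/ler_addgt0Pl => e e0; rewrite addrC.
have [N N0 NP] := v_from_le_v_star F0 r01 Ztb runif Fne e0.
apply: le_trans (NP N (leqnn _) m z).
by apply: (@inf_image_le _ _ _ _ 0) => // n; exact: v_from_ge0.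
Qed.

End uniform_value.

Theorem corollary3p9 (R : realType) (Z : metricType R)
    (F : Z -> set Z) (r : Z -> R)
    (Z_nonempty : [set: Z] !=set0)
    (F_nonempty : forall z : Z, F z !=set0)
    (r_01 : forall z : Z, 0 <= r z <= 1)
    (Z_precompact : totally_bounded Z)
    (r_unif_cont : unif_continuous r)
    (F_nonexpansive : nonexpansive F) :
  (forall z : Z,
     is_uniform_value F r z (v_star F r z) /\
     [/\ v_star F r z = v_low F r z,
         v_low F r z = v_plus F r z,
         v_plus F r z = v_minus F r z,
         v_minus F r z = supinf_v F r z &
         supinf_v F r z = supinf_w F r z]) /\
  {uniform, v F r @ \oo --> v_star F r}.
Proof.
split=> [z|].
  have [v_minusE v_plusE] := cvg_limn_inf_sup
    (v_cvg F_nonempty r_01 Z_precompact r_unif_cont F_nonexpansive (z := z)).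
  have v_lowE : v_low F r z = v_star F r z.
    by apply/eqP; rewrite eq_le v_low_le_v_star ?v_star_le_v_low.
  have le1 : v_star F r z <= supinf_w F r z by exact: v_star_le_supinf_w.
  have le2 : supinf_w F r z <= supinf_v F r z by exact: supinf_w_le_supinf_v.
  have le3 : supinf_v F r z <= v_star F r z by exact: supinf_v_le_v_star.
  rewrite /is_uniform_value /has_uniform_value /v_plus /v_minus.
  rewrite v_minusE v_plusE v_lowE; split=> //; split=> //; lra.
move=> P /uniform_nbhs[E [entE EP]].
move: entE; rewrite -entourage_ballE => -[e /= e0 eE].
have e2 : 0 < e / 2 by lra.
have [N NP] :=
  v_cvg_uniform F_nonempty r_01 Z_precompact r_unif_cont F_nonexpansive e2.
exists N => // n Nn; apply: EP => z _; apply: eE.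
rewrite /= -ball_normE /=; have := NP n Nn z; lra.
Qed.
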